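(* Assume: (i) $\mathbf h(\mathbf r_j^T\mathbf x)\in\mathrm{Ran}(\boldsymbol\Xi_j)$ for $j=1,\dots,\bar N$; (ii) the local time-evolution bases are constructed with no truncation, i.e. with energy criterion $\upsilon=1$; (iii) $\mathbf P\mathbf R^T=\mathbf R^T\mathbf P=\mathbf I_N$ with $\bar N=N$; (iv) the parareal algorithm is initialized by local forecasting, i.e. $\mathbf x_0^{n+1}=\mathcal G_{\mathrm{LF}}(\mathbf x_0^n;T^n,T^{n+1})$ for $n=0,\dots,M-1$. Then the parareal method with coarse propagator $\mathcal G=\mathcal G_{\mathrm{LF}}$ converges after initialization, i.e. $K=0$. Further, if the wall time incurred by computing time advancement over one fine time step with the fine propagator dominates all other costs and parallel overhead (the number of processors being equal to $M$), then the method realizes a speedup of $$S_{\mathrm{LF\text{-}LF}}(0)=\frac{m}{(M-1)\alpha+\bar m}.$$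
   Context: Let $N,M,\bar m$ be positive integers, $m=\bar m M$, $T_{\mathrm{final}}>0$, $h=T_{\mathrm{final}}/m$, $H=\bar m h$; fine time instances $t^i=ih$ ($0\le i\le m$), coarse time instances $T^n=nH=t^{\bar m n}$ ($0\le n\le M$). The fine propagator $\mathcal F(\boldsymbol\xi;t^i,t^j)\in\mathbb R^N$ propagates a state $\boldsymbol\xi\in\mathbb R^N$ from $t^i$ to $t^j$ ($i\le j$), with $\mathcal F(\cdot;t^i,t^k)=\mathcal F(\cdot;t^j,t^k)\circ\mathcal F(\cdot;t^i,t^j)$ for $i\le j\le k$; it typically corresponds to a single-step time integrator. For the initial state $\mathbf x^0\in\mathbb R^N$, the numerical solution is $\mathbf x(t^i):=\mathcal F(\mathbf x^0;0,t^i)$. Let $1\le\bar N\le N$, $\mathbf R=[\mathbf r_1\ \cdots\ \mathbf r_{\bar N}]\in\mathbb R^{N\times\bar N}$ (restriction operator $\mathbf R^T$), $\mathbf P\in\mathbb R^{N\times\bar N}$ (prolongation operator). $\mathbf e_i$ denotes canonical unit vectors, $^+$ the Moore--Penrose pseudoinverse, $\mathrm{Ran}$ the range. For $y:\{t^0,\dots,t^m\}\to\mathbb R$ let $\mathbf h(y)=[y(t^1)-y(t^0)\ \cdots\ y(t^m)-y(t^0)]^T\in\mathbb R^m$; $\mathbf r_j^T\mathbf x$ denotes the function $t^i\mapsto\mathbf r_j^T\mathbf x(t^i)$. For $j=1,\dots,\bar N$, the (global) time-evolution basis $\boldsymbol\Xi_j\in\mathbb R^{m\times a}$ has orthonormal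 columns. The local bases $\boldsymbol\Xi_j^n$, $0\le n\le M-1$, are obtained from $\boldsymbol\Xi_j$ and an energy criterion $\upsilon\in[0,1]$ as follows: let $\mathbf Z^n=[\mathbf e_{\bar m n+1}\ \cdots\ \mathbf e_{\bar m(n+1)}]^T-\mathbf 1_{\bar m}[\mathbf e_{\bar m n}]^T\in\mathbb R^{\bar m\times m}$ ($\mathbf 1_{\bar m}$ the all-ones vector, $\mathbf e_0:=\mathbf 0$); compute a thin singular value decomposition of $\mathbf Z^n\boldsymbol\Xi_j$ with left singular vectors $\mathbf u_1,\mathbf u_2,\dots$ and singular values $\sigma_1\ge\sigma_2\ge\cdots$; then $\boldsymbol\Xi_j^n=[\mathbf u_1\ \cdots\ \mathbf u_{i^*}]$, where $i^*\ge1$ is the smallest index with $\sum_{\ell=1}^{i^*}\sigma_\ell\ge\upsilon\sum_\ell\sigma_\ell$. The memory is an integer $\alpha$ with $a\le\alpha\le\bar m$; $\mathbf Z_0\in\{0,1\}^{\alpha\times\bar m}$ extracts the first $\alpha$ entries of a vector in $\mathbb R^{\bar m}$. With $\gamma_{ij}^n:=\mathbf e_{\bar m}^T\boldsymbol\Xi_j^n[\mathbf Z_0\boldsymbol\Xi_j^n]^+\mathbf e_i$ and $\boldsymbol\Gamma_i^n:=\mathrm{diag}(\gamma_{i1}^n,\dots,\gamma_{i\bar N}^n)$, the local-forecast coarse propagator is $$\mathcal G_{\mathrm{LF}}(\boldsymbol\xi;T^n,T^{n+1})=\mathbf P\mathbf R^T\boldsymbol\xi+\mathbf P\sum_{i=1}^{\alpha}\boldsymbol\Gamma_i^n[\mathbf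 R^T\mathcal F(\boldsymbol\xi;T^n,t^{\bar m n+i})-\mathbf R^T\boldsymbol\xi].$$ The $\alpha$ applications of the fine propagator employed by it on a coarse interval are reused during the subsequent fine propagation there. Parareal algorithm (inputs $\mathcal F$, $\mathcal G$, $\mathbf x_0^0=\mathbf x^0$, tolerance $\epsilon$): (1) compute an initialization $\mathbf x_0^1,\dots,\mathbf x_0^M$. (2) In parallel, $\mathbf f_0^{n+1}=\mathcal F(\mathbf x_0^n;T^n,T^{n+1})$, $n=0,\dots,M-1$; set $k=0$. (3) While $\|\mathbf f_k^n-\mathbf x_k^n\|/\|\mathbf f_k^n\|>\epsilon$ for some $n\in\{k+1,\dots,M-1\}$: (a) if $k=0$, compute in parallel $\mathbf g_0^{n+1}=\mathcal G(\mathbf x_0^n;T^n,T^{n+1})$, $n=1,\dots,M-1$ (and $\mathbf g_0^1=\mathbf g_1^1$); (b) $\mathbf x_{k+1}^k=\mathbf x_k^k$; (c) serially for $n=k,\dots,M-1$: $\mathbf g_{k+1}^{n+1}=\mathcal G(\mathbf x_{k+1}^n;T^n,T^{n+1})$, $\mathbf x_{k+1}^{n+1}=\mathbf g_{k+1}^{n+1}+\mathbf f_k^{n+1}-\mathbf g_k^{n+1}$; (d) in parallel $\mathbf f_{k+1}^{n+1}=\mathcal F(\mathbf x_{k+1}^n;T^n,T^{n+1})$, $n=k,\dots,M-1$; then $k\leftarrow k+1$. (4) Replace $\mathbf x_k^{n+1}$ by $\mathbf f_k^{n+1}$, $n=k,\dots,M-1$. $K$ denotes the final value of $k$ (the number of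 parareal iterations). Speedup is the ratio of the wall time of the serial solution with the fine propagator (over all $m$ fine time steps) to the wall time of the parareal method.
   Formalization: It is additionally assumed that Z_0 Ξ_j^n has full column rank whenever Z^n Ξ_j is nonzero (0 ≤ n ≤ M−1); without this the forecast can miss the increments and the claim K=0 fails, since a ≤ α does not imply it. *)

(* Defs.v *)
From HB Require Import structures.
From mathcomp Require Import all_boot all_order all_algebra.
From mathcomp Require Import all_classical all_reals all_analysis.

Set Implicit Arguments.
Unset Strict Implicit.
Unset Printing Implicit Defensive.
Import Order.TTheory GRing.Theory Num.Theory.
Import numFieldNormedType.Exports.
Local Open Scope classical_set_scope.
Local Open Scope ring_scope.

Section LinearAlgebra.
Variable R : realType.

(* Canonical unit vectors are indexed from 1, so that [ev d 0 = 0]. *)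
Definition ev (d k : nat) : 'cV[R]_d := \col_(i < d) (i.+1 == k)%:R.

(* Euclidean norm; the norm [`|v|] of the library is the max norm. *)
Definition norm2 (d : nat) (v : 'cV[R]_d) : R :=
  Num.sqrt (\sum_i v i 0 ^+ 2).

Definition penrose (p q : nat) (A : 'M[R]_(p, q)) (B : 'M[R]_(q, p)) : Prop :=
  [/\ A *m B *m A = A, B *m A *m B = B,
      (A *m B)^T = A *m B & (B *m A)^T = B *m A].

(* Moore-Penrose pseudoinverse. It differs from the library's [pinvmx], which
   only satisfies the first of the four Penrose equations. *)
Definition mpinv (p q : nat) (A : 'M[R]_(p, q)) : 'M[R]_(q, p) :=
  xget 0 [set B | penrose A B].

Definition thin_svd (p q : nat) (A : 'M[R]_(p, q)) (U : 'M[R]_(p, minn p q))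
    (s : 'rV[R]_(minn p q)) (V : 'M[R]_(q, minn p q)) : Prop :=
  [/\ U^T *m U = 1%:M, V^T *m V = 1%:M,
      forall l, 0 <= s 0 l,
      forall l l' : 'I_(minn p q), (l <= l')%N -> s 0 l' <= s 0 l
    & A = U *m diag_mx s *m V^T].

(* [w] is the smallest [i >= 1] such that the [i] first entries of [s] carry
   the fraction [ups] of the sum of all entries. *)
Definition energy_index (ups : R) (d : nat) (s : 'rV[R]_d) (w : nat) : Prop :=
  let reached i := ups * (\sum_l s 0 l) <= \sum_(l < d | (l < i)%N) s 0 l in
  [/\ (1 <= w)%N, reached w & forall i, (1 <= i)%N -> reached i -> (w <= i)%N].

(* [X] consists of the [w] leading left singular vectors of some thin SVD of
   [A] (which is not unique), [w] being selected by the energy criterion. *)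
Definition truncated_left_basis (ups : R) (p q : nat) (A : 'M[R]_(p, q))
    (w : nat) (X : 'M[R]_(p, w)) : Prop :=
  exists U s V, thin_svd A U s V /\ energy_index ups s w /\
    exists hw : (w <= minn p q)%N, X = colsub (widen_ord hw) U.

Lemma gram_unit (r n : nat) (B : 'M[R]_(r, n)) :
  row_free B -> B *m B^T \in unitmx.
Proof.
move=> Bfree; rewrite -row_free_unit -kermx_eq0; apply/eqP/row_matrixP => i.
rewrite row0; set v := row i _.
have vG : v *m (B *m B^T) = 0 by apply/sub_kermxP; exact: row_sub.
have vB : v *m B = 0.
  have h0 : ((v *m B) *m (v *m B)^T) 0 0 = 0.
    by rewrite trmx_mul !mulmxA -(mulmxA v) vG mul0mx mxE.
  rewrite mxE in h0; apply/rowP => j; rewrite [RHS]mxE.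
  have sq k : (v *m B) 0 k * (v *m B)^T k 0 = (v *m B) 0 k ^+ 2.
    by rewrite [in X in _ * X]mxE expr2.
  have ge0 k : true -> 0 <= (v *m B) 0 k * (v *m B)^T k 0.
    by rewrite sq sqr_ge0.
  have := psumr_eq0P ge0 h0 (i := j) isT.
  by rewrite sq => /eqP; rewrite sqrf_eq0 => /eqP.
by apply: (row_free_inj Bfree); rewrite vB mul0mx.
Qed.

Lemma penrose_factor (p r q : nat) (C : 'M[R]_(p, r)) (B : 'M[R]_(r, q)) :
  row_free C^T -> row_free B ->
  penrose (C *m B) (B^T *m invmx (B *m B^T) *m (invmx (C^T *m C) *m C^T)).
Proof.
move=> /gram_unit; rewrite trmxK => uC /gram_unit uB.
set X := (X in penrose _ X).
have sB : (invmx (B *m B^T))^T = invmx (B *m B^T).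
  by rewrite trmx_inv trmx_mul trmxK.
have sC : (invmx (C^T *m C))^T = invmx (C^T *m C).
  by rewrite trmx_inv trmx_mul trmxK.
have BX : B *m X = invmx (C^T *m C) *m C^T.
  by rewrite /X !mulmxA mulmxV // mul1mx.
have XC : X *m C = B^T *m invmx (B *m B^T).
  by rewrite /X -!mulmxA mulVmx // mulmx1.
have AX : C *m B *m X = C *m invmx (C^T *m C) *m C^T.
  by rewrite -mulmxA BX mulmxA.
have XA : X *m (C *m B) = B^T *m invmx (B *m B^T) *m B.
  by rewrite mulmxA XC.
split.
- by rewrite AX -!mulmxA (mulmxA C^T) (mulmxA (invmx _)) mulVmx // mul1mx.
- by rewrite XA -mulmxA BX.
- by rewrite AX !trmx_mul trmxK sC mulmxA.
- by rewrite XA !trmx_mul trmxK sB mulmxA.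
Qed.

Lemma mpinvP (p q : nat) (A : 'M[R]_(p, q)) : penrose A (mpinv A).
Proof.
have := @penrose_factor _ _ _ (col_base A) (row_base A) _ (row_base_free A).
rewrite mulmx_base => h; apply: xgetPex; eexists; apply: h.
by rewrite /row_free mxrank_tr; exact: col_base_full.
Qed.

Lemma penrose_unique (p q : nat) (A : 'M[R]_(p, q)) (B C : 'M[R]_(q, p)) :
  penrose A B -> penrose A C -> B = C.
Proof.
move=> [B1 B2 B3 B4] [C1 C2 C3 C4].
have EAB : A *m B = A *m C.
  by rewrite -B3 -[in LHS]C1 -mulmxA trmx_mul B3 C3 mulmxA B1.
have EBA : B *m A = C *m A.
  by rewrite -B4 -[in LHS]C1 -!mulmxA mulmxA trmx_mul C4 B4 -mulmxA (mulmxA A) B1.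
by rewrite -B2 EBA -mulmxA EAB mulmxA C2.
Qed.

End LinearAlgebra.

Section TimeGrid.
Variables (R : realType) (Tfinal : R) (m mbar : nat).

Definition hstep : R := Tfinal / m%:R.
Definition tfine (i : nat) : R := i%:R * hstep.
Definition tcoarse (n : nat) : R := n%:R * (mbar%:R * hstep).

Lemma tcoarseE (n : nat) : tcoarse n = tfine (mbar * n).
Proof. by rewrite /tcoarse /tfine mulrA -natrM mulnC. Qed.

(* [F xi s t] propagates the state [xi] from time [s] to time [t]; it is only
   constrained on fine time instances. *)
Definition fine_propagator (N : nat) (F : 'cV[R]_N -> R -> R -> 'cV[R]_N) :=
  (forall i xi, (i <= m)%N -> F xi (tfine i) (tfine i) = xi) /\
  (forall i j k xi, (i <= j)%N -> (j <= k)%N -> (k <= m)%N ->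
     F xi (tfine i) (tfine k) = F (F xi (tfine i) (tfine j)) (tfine j) (tfine k)).

Definition hvec (y : R -> R) : 'cV[R]_m :=
  \col_(i < m) (y (tfine i.+1) - y (tfine 0)).

Definition Zmx (n : nat) : 'M[R]_(mbar, m) :=
  \matrix_(r < mbar) ((ev R m (mbar * n + r.+1))^T - (ev R m (mbar * n))^T).

End TimeGrid.

Section LocalForecast.
Variables (R : realType) (Tfinal : R) (N Nbar m mbar alpha : nat).
Variable F : 'cV[R]_N -> R -> R -> 'cV[R]_N.
Variables Rr P : 'M[R]_(N, Nbar).
Variable w : nat -> 'I_Nbar -> nat.
Variable Xi : forall n j, 'M[R]_(mbar, w n j).

Definition Z0 : 'M[R]_(alpha, mbar) := \matrix_(i < alpha) (ev R mbar i.+1)^T.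

Definition gamma (n i : nat) (j : 'I_Nbar) : R :=
  ((ev R mbar mbar)^T *m Xi n j *m mpinv (Z0 *m Xi n j) *m ev R alpha i) 0 0.

Definition Gamma (n i : nat) : 'M[R]_Nbar := diag_mx (\row_j gamma n i j).

(* [G_LF xi n] propagates [xi] from [T^n] to [T^(n+1)]. *)
Definition G_LF (xi : 'cV[R]_N) (n : nat) : 'cV[R]_N :=
  P *m Rr^T *m xi + P *m \sum_(1 <= i < alpha.+1)
    Gamma n i *m (Rr^T *m F xi (tcoarse Tfinal m mbar n)
                                (tfine Tfinal m (mbar * n + i)) - Rr^T *m xi).

End LocalForecast.

Section Parareal.
Variables (R : realType) (N M : nat).
(* One coarse interval: [Fc xi n] and [G xi n] go from [T^n] to [T^(n+1)]. *)
Variables Fc G : 'cV[R]_N -> nat -> 'cV[R]_N.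
Variable eps : R.
Variable xinit : nat -> 'cV[R]_N.

(* The sequences [x_k^n], [f_k^n], [g_k^n] for a fixed [k], as functions of
   [n]; the algorithm uses [f_k^n] and [g_k^n] for [n >= 1] only. *)
Record pstate := PState {
  px : nat -> 'cV[R]_N; pf : nat -> 'cV[R]_N; pg : nat -> 'cV[R]_N }.

(* Step (3a) sets [g_0^1 = g_1^1 = G x_1^0], and [x_1^0 = x_0^0] by (3b). *)
Definition pinit : pstate := PState xinit
  (fun n => if n is n'.+1 then Fc (xinit n') n' else 0)
  (fun n => if n is n'.+1 then G (xinit n') n' else 0).

(* Quantities with index [n <= k] are kept, which includes step (3b). *)
Fixpoint sweep (k : nat) (st : pstate) (n : nat) : 'cV[R]_N :=
  match n with
  | 0 => px st 0
  | n'.+1 => if (n' < k)%N then px st n'.+1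
             else G (sweep k st n') n' + pf st n'.+1 - pg st n'.+1
  end.

Definition pstep (k : nat) (st : pstate) : pstate :=
  let x' := sweep k st in PState x'
  (fun n => if n is n'.+1 then
              if (n' < k)%N then pf st n else Fc (x' n') n' else 0)
  (fun n => if n is n'.+1 then
              if (n' < k)%N then pg st n else G (x' n') n' else 0).

Fixpoint parareal (k : nat) : pstate :=
  if k is k'.+1 then pstep k' (parareal k') else pinit.

(* A quotient with [f_k^n = 0] is [0] by the convention on division. *)
Definition pstop (k : nat) : bool :=
  let st := parareal k in
  [forall n : 'I_M, (k < n)%N ==>
     ~~ (eps < norm2 (pf st n - px st n) / norm2 (pf st n))].

(* First [k] at which the while loop stops; [pstop M.-1] holds vacuously, so
   for [M > 0] the search always succeeds. *)
Definition parareal_iterations : nat := find pstop (iota 0 M).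

End Parareal.

Section WallTime.
Variable R : realType.

(* A computation on [p] processors is a sequence of synchronized stages; a
   stage gives the number of fine time steps that each processor computes.
   [tau] is the wall time of one fine time step, [other s i] is the time of
   everything else (communication included) done by processor [i] in stage
   [s]. *)
Definition wall_time (p : nat) (tau : R) (other : nat -> 'I_p -> R)
    (stages : seq ('I_p -> nat)) : R :=
  \sum_(0 <= s < size stages) \big[Num.max/0]_(i < p)
     ((nth (fun=> 0%N) stages s i)%:R * tau + other s i).

Definition serial_stages (m : nat) : seq ('I_1 -> nat) := nseq m (fun=> 1%N).

Section LFLF.
Variables M mbar alpha : nat.

(* Local forecasting on interval [n] takes [alpha] fine steps, alone. *)
Definition forecast_stage (n : nat) : 'I_M -> nat :=
  fun i => if i == n :> nat then alpha else 0%N.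

(* Fine propagation on the intervals [k, ..., M-1] in parallel: the first
   [alpha] fine steps are reused from the forecasts started at the same
   states. *)
Definition fine_stage (k : nat) : 'I_M -> nat :=
  fun i => if (k <= i)%N then (mbar - alpha)%N else 0%N.

Definition iteration_stages (k : nat) : seq ('I_M -> nat) :=
  rcons [seq forecast_stage n | n <- iota k (M - k)] (fine_stage k).

(* Parareal with [K] iterations where initialization and coarse propagation
   are both local forecasts. Step (3a) needs no fine step, since its values
   [G x_0^n] are those computed by the initialization. *)
Definition lf_lf_stages (K : nat) : seq ('I_M -> nat) :=
  rcons [seq forecast_stage n | n <- iota 0 M] (fine_stage 0)
  ++ flatten [seq iteration_stages k | k <- iota 0 K].

End LFLF.

(* One fine time step dominates all other costs: along the family indexed by
   [l], their ratio tends to 0. *)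
Definition dominated (p : nat) (tau : nat -> R)
    (other : nat -> nat -> 'I_p -> R) : Prop :=
  (forall l s i, 0 <= other l s i) /\
  (forall s i, other l s i / tau l @[l --> \oo] --> (0 : R)).

End WallTime.

(* Main.v *)
(* The local increments of r_j^T x on the n-th coarse interval form the vector
   Z^n h(r_j^T x), which lies in Ran (Z^n Xi_j) by (i), hence in Ran Xi_j^n as no
   nonzero singular value is discarded. When Z_0 Xi_j^n has full column rank,
   least squares recover such a vector from its first alpha entries, so G_LF
   agrees with the fine propagator along the fine solution. By induction the
   initialization is the fine solution at the coarse instances, and the stopping
   test holds at k = 0. There remain M sequential forecasts of alpha fine steps,
   then mbar - alpha fine steps in parallel. *)

Require Import Defs.
From HB Require Import structures.
From mathcomp Require Import all_boot all_order all_algebra.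
From mathcomp Require Import all_classical all_reals all_analysis.

Set Implicit Arguments.
Unset Strict Implicit.
Unset Printing Implicit Defensive.
Import Order.TTheory GRing.Theory Num.Theory.
Import numFieldNormedType.Exports.
Local Open Scope classical_set_scope.
Local Open Scope ring_scope.

(** * Pseudoinverses and untruncated singular bases *)

Section Matrices.
Variable R : realType.

Lemma evE (d : nat) (i : 'I_d) : ev R d i.+1 = delta_mx i 0.
Proof. by apply/colP => k; rewrite !mxE eqSS eqxx andbT. Qed.

Lemma ev0 (d : nat) : ev R d 0 = 0.
Proof. by apply/colP => k; rewrite !mxE. Qed.

Lemma Z0_mulE (mbar alpha q : nat) (h : (alpha <= mbar)%N)
    (A : 'M[R]_(mbar, q)) :
  Z0 R mbar alpha *m A = rowsub (widen_ord h) A.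
Proof.
apply/row_matrixP => i; rewrite row_mul rowK row_rowsub.
by rewrite (evE (widen_ord h i)) trmx_delta -rowE.
Qed.

(** Full column rank gives a left inverse of [A], which cancels the leading [A] in the first Penrose
    equation. *)
Lemma mpinv_mulV (p q : nat) (A : 'M[R]_(p, q)) :
  \rank A = q -> mpinv A *m A = 1%:M.
Proof.
move=> rA; have /row_fullP[B BA] : row_full A by rewrite /row_full rA.
have [AXA _ _ _] := mpinvP A.
by rewrite -[LHS]mul1mx -BA -mulmxA (mulmxA A) AXA.
Qed.

(* With energy criterion 1, the discarded singular values all vanish. *)
Lemma truncated_left_basis1_range (p q w : nat) (A : 'M[R]_(p, q))
    (X : 'M[R]_(p, w)) :
  truncated_left_basis 1 A X -> exists B, A = X *m B.
Proof.
move=> [U [s [V [[_ _ s0 _ AE] [[_ reached _] [hw XE]]]]]].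
have tail0 (l : 'I_(minn p q)) : ~~ (l < w)%N -> s 0 l = 0.
  move: l; apply: (@psumr_eq0P _ _ (fun l : 'I_(minn p q) => ~~ (l < w)%N)
    (fun l => s 0 l)) => [l _|].
    exact: s0.
  (* At energy 1 the leading singular values already sum to at least the total, so the nonnegative
     tail sum is at most 0. *)
  apply/eqP; rewrite eq_le sumr_ge0 // andbT.
  move: reached; rewrite mul1r.
  by rewrite (bigID (fun l : 'I_(minn p q) => (l < w)%N)) /= gerDl.
(* The SVD restricted to its leading [w] terms; [tail0] kills the others. *)
exists (diag_mx (colsub (widen_ord hw) s) *m (colsub (widen_ord hw) V)^T).
rewrite AE XE; apply/matrixP => i j; rewrite -mulmxA !mxE.
rewrite (bigID (fun l : 'I_(minn p q) => (l < w)%N)) /= [X in _ + X]big1 ?addr0.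
  rewrite (big_ord_narrow hw); apply: eq_bigr => k _.
  by rewrite !mul_diag_mx !mxE.
by move=> l /tail0 sl; rewrite mul_diag_mx !mxE sl mul0r mulr0.
Qed.

Lemma local_forecast_exact (mbar alpha q w : nat) (A : 'M[R]_(mbar, q))
    (X : 'M[R]_(mbar, w)) (c : 'cV[R]_q) :
  truncated_left_basis 1 A X ->
  (A != 0 -> \rank (Z0 R mbar alpha *m X) = w) ->
  X *m mpinv (Z0 R mbar alpha *m X) *m (Z0 R mbar alpha *m (A *m c)) = A *m c.
Proof.
move=> /truncated_left_basis1_range[B AE].
(* If [A = 0], the energy criterion keeps one arbitrary unit column, which [Z0] may annihilate; both
   sides are then 0. *)
have [-> _|_ /(_ isT) /mpinv_mulV rk] := eqVneq A 0.
  by rewrite mul0mx !mulmx0.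
rewrite AE -!(mulmxA X); congr (X *m _).
by rewrite (mulmxA _ X) (mulmxA (mpinv _)) rk mul1mx.
Qed.

End Matrices.

(** * Exactness of the local forecast along the fine solution *)

Section Forecast.
Variables (R : realType) (Tfinal : R) (m mbar : nat).

Local Notation t := (tfine Tfinal m).

(** The convention that the unit vector of index 0 vanishes matches the zero increment at [k = 0],
    so the first coarse interval needs no separate treatment. *)
Lemma ev_hvec (y : R -> R) (k : nat) : (k <= m)%N ->
  (ev R m k)^T *m hvec Tfinal m y = (y (t k) - y (t 0))%:M.
Proof.
case: k => [|k] km; first by rewrite ev0 trmx0 mul0mx subrr raddf0.
rewrite (evE _ (Ordinal km)) trmx_delta -rowE.
by apply/rowP => i; rewrite !mxE ord1 eqxx mulr1n.
Qed.

Lemma Zmx_hvec (y : R -> R) (n : nat) (r : 'I_mbar) :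
  (mbar * n + r.+1 <= m)%N ->
  (Zmx R m mbar n *m hvec Tfinal m y) r 0 =
    y (t (mbar * n + r.+1)) - y (t (mbar * n)).
Proof.
move=> h; have h' : (mbar * n <= m)%N := leq_trans (leq_addr _ _) h.
have -> : (Zmx R m mbar n *m hvec Tfinal m y) r 0 =
          row r (Zmx R m mbar n *m hvec Tfinal m y) 0 0 by rewrite !mxE.
rewrite row_mul rowK mulmxBl !ev_hvec // -raddfB !mxE eqxx mulr1n.
by rewrite opprB addrA subrK.
Qed.

Variables (M N Nbar alpha : nat).
Hypothesis mE : m = (mbar * M)%N.
Hypotheses (mbar_gt0 : (0 < mbar)%N) (alpha_le : (alpha <= mbar)%N).
Variable F : 'cV[R]_N -> R -> R -> 'cV[R]_N.
Hypothesis F_propagator : fine_propagator Tfinal m F.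
Variables (Rr P : 'M[R]_(N, Nbar)) (x0 : 'cV[R]_N).

Lemma fine_index_leq (n r : nat) : (n < M)%N -> (r <= mbar)%N ->
  (mbar * n + r <= m)%N.
Proof.
move=> nM rm; rewrite mE (leq_trans _ (leq_mul (leqnn mbar) nM)) //.
by rewrite mulnS addnC leq_add2r.
Qed.

Lemma fine_restart (i k : nat) : (i <= k)%N -> (k <= m)%N ->
  F (F x0 0 (t i)) (t i) (t k) = F x0 0 (t k).
Proof.
have <- : t 0 = 0 by rewrite /tfine mul0r.
by case: F_propagator => _ comp ik km; rewrite -comp.
Qed.

Variables (w : nat -> 'I_Nbar -> nat).
Variable Xiloc : forall n j, 'M[R]_(mbar, w n j).

Lemma gammaE (n : nat) (j : 'I_Nbar) (r : 'I_mbar) (i : 'I_alpha) :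
  r.+1 = mbar ->
  gamma alpha Xiloc n i.+1 j =
    (Xiloc n j *m mpinv (Z0 R mbar alpha *m Xiloc n j)) r i.
Proof.
move=> rE; rewrite /gamma (_ : ev R mbar mbar = delta_mx r 0); last first.
  by rewrite -evE rE.
by rewrite evE trmx_delta -2!mulmxA -rowE mulmxA -colE !mxE.
Qed.

Variables (a : nat) (Xi : 'I_Nbar -> 'M[R]_(m, a)).
Hypothesis Xiloc_basis : forall n j, (n < M)%N ->
  truncated_left_basis 1 (Zmx R m mbar n *m Xi j) (Xiloc n j).
Hypothesis well_posed : forall n j, (n < M)%N ->
  Zmx R m mbar n *m Xi j != 0 ->
  \rank (Z0 R mbar alpha *m Xiloc n j) = w n j.
Hypothesis Xi_range : forall j,
  range (mulmx (Xi j) : 'cV[R]_a -> 'cV[R]_m)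
    (hvec Tfinal m (fun t => (Rr^T *m F x0 0 t) j 0)).
Hypothesis PRr : P *m Rr^T = 1%:M.

Lemma G_LF_exact (n : nat) : (n < M)%N ->
  G_LF Tfinal m alpha F Rr P Xiloc (F x0 0 (tcoarse Tfinal m mbar n)) n =
    F x0 0 (tcoarse Tfinal m mbar n.+1).
Proof.
move=> nM; rewrite /G_LF !tcoarseE mulnS (addnC mbar).
set S := \sum_(_ <= _ < _) _.
(* Since [P *m Rr^T] is the identity, it remains to forecast the restricted increment over the whole
   coarse interval, one component at a time. *)
suff -> : S = Rr^T *m F x0 0 (t (mbar * n + mbar))
              - Rr^T *m F x0 0 (t (mbar * n)).
  by rewrite -mulmxBr !mulmxA PRr !mul1mx addrC subrK.
apply/colP => j; pose y s := (Rr^T *m F x0 0 s) j 0.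
(* The end of the coarse interval is the last row, of index [mbar.-1] counting from 0. *)
have pm : (mbar.-1 < mbar)%N by rewrite prednK.
have [c _ cE] := Xi_range j.
have := local_forecast_exact c (Xiloc_basis j nM) (well_posed nM).
rewrite -!mulmxA cE mulmxA => /colP/(_ (Ordinal pm)).
have inm k : (k < mbar)%N -> (mbar * n + k.+1 <= m)%N.
  by move=> km; exact: fine_index_leq.
rewrite [RHS]Zmx_hvec /= ?prednK ?fine_index_leq // => E.
rewrite [RHS](_ : _ = y (t (mbar * n + mbar)) - y (t (mbar * n))); last first.
  by rewrite [LHS]mxE [X in _ + X]mxE.
rewrite -{}E /S big_add1 big_mkord summxE [RHS]mxE.
apply: eq_bigr => i _.
(* The sampled entries are the increments over the first [alpha] fine steps, which restarting [F] at
   the coarse instance reproduces. *)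
rewrite (Z0_mulE alpha_le (_ *m hvec _ _ _)) [X in _ = _ * X]mxE.
rewrite Zmx_hvec ?inm //=; last exact: leq_trans alpha_le.
rewrite mul_diag_mx 2!mxE (gammaE _ _ (r := Ordinal pm)) /= ?prednK //.
rewrite fine_restart ?leq_addr ?inm ?(leq_trans _ alpha_le) //.
by rewrite !mxE.
Qed.

End Forecast.

(** * Asymptotic wall times *)

Section Time.
Variable R : realType.

(** Wall time in units of one fine step, all other costs being dropped. *)
Definition ideal_cost (p : nat) (stages : seq ('I_p -> nat)) : R :=
  \sum_(st <- stages) \big[Num.max/0]_(i < p) (st i)%:R.

Lemma bigmax_divr (p : nat) (f : 'I_p -> R) (c : R) : 0 < c ->
  (\big[Num.max/0]_(i < p) f i) / c = \big[Num.max/0]_(i < p) (f i / c).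
Proof.
move=> c0; apply: (big_morph (fun x => x / c)) => [x y|]; last by rewrite mul0r.
by rewrite maxr_pMl // invr_ge0 ltW.
Qed.

(** Dividing by [tau l] commutes with finite sums and maxima, which are continuous; each overhead
    ratio tends to 0. *)
Lemma wall_time_cvg (p : nat) (tau : nat -> R) (other : nat -> nat -> 'I_p -> R)
    (stages : seq ('I_p -> nat)) :
  (forall l, 0 < tau l) -> dominated tau other ->
  wall_time (tau l) (other l) stages / tau l @[l --> \oo] -->
    ideal_cost stages.
Proof.
move=> tau0 [_ other0]; rewrite /ideal_cost (big_nth (fun=> 0%N)) /wall_time.
under eq_cvg do rewrite mulr_suml.
apply: cvg_big => [|s _]; first exact: add_continuous.
under eq_cvg do rewrite bigmax_divr //.
apply: cvg_big => [|i _]; first exact: max_continuous.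
under eq_cvg do rewrite mulrDl mulfK ?gt_eqF //.
have := cvgD (cvg_cst ((nth (fun=> 0%N) stages s i)%:R : R)) (other0 s i).
by rewrite addr0; apply.
Qed.

Lemma bigmax_natr (p : nat) (f : 'I_p -> nat) (i0 : 'I_p) :
  (forall i, f i <= f i0)%N -> \big[Num.max/0]_(i < p) (f i)%:R = (f i0)%:R :> R.
Proof.
move=> fmax; apply/eqP; rewrite eq_le (le_bigmax _ (fun i => (f i)%:R)) andbT.
by apply/bigmax_leP; split=> [|i _]; rewrite ?ler0n // ler_nat.
Qed.

Lemma ideal_cost_serial (m : nat) : ideal_cost (serial_stages m) = m%:R.
Proof.
rewrite /ideal_cost big_nseq (bigmax_natr (i0 := ord0)) //.
by rewrite iter_addr_0.
Qed.

Lemma ideal_cost_lf_lf (M mbar alpha : nat) :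
  (0 < M)%N -> (alpha <= mbar)%N ->
  ideal_cost (lf_lf_stages M mbar alpha 0) =
    (M%:R - 1) * alpha%:R + mbar%:R.
Proof.
move=> M0 am; rewrite /ideal_cost /lf_lf_stages cats0 -cats1 big_cat big_seq1 /=.
rewrite big_map -{1}[M]subn0 -/(index_iota 0 M) big_mkord.
rewrite (eq_bigr (fun=> alpha%:R)) => [|n _].
  rewrite sumr_const card_ord (bigmax_natr (i0 := Ordinal M0)) //= natrB //.
  by rewrite mulrBl mul1r mulr_natl addrA addrAC.
rewrite (bigmax_natr (i0 := n)) /forecast_stage ?eqxx // => i.
by case: ifP.
Qed.

End Time.

Lemma parareal_iterations_eq0 (R : realType) (N M : nat)
    (Fc G : 'cV[R]_N -> nat -> 'cV[R]_N) (eps : R) (xinit : nat -> 'cV[R]_N) :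
  (0 < M)%N -> pstop M Fc G eps xinit 0 ->
  parareal_iterations M Fc G eps xinit = 0%N.
Proof. by case: M => // M _; rewrite /parareal_iterations /= => ->. Qed.

Theorem theorem4p6 (R : realType) (N M mbar m Nbar a alpha : nat)
  (Tfinal : R)
  (N_gt0 : (0 < N)%N) (M_gt0 : (0 < M)%N) (mbar_gt0 : (0 < mbar)%N)
  (mE : m = (mbar * M)%N) (Tfinal_gt0 : 0 < Tfinal)
  (Nbar_range : (1 <= Nbar <= N)%N) (a_gt0 : (0 < a)%N)
  (alpha_range : (a <= alpha <= mbar)%N)
  (F : 'cV[R]_N -> R -> R -> 'cV[R]_N)
  (F_propagator : fine_propagator Tfinal m F)
  (Rr P : 'M[R]_(N, Nbar)) (x0 : 'cV[R]_N)
  (Xi : 'I_Nbar -> 'M[R]_(m, a))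
  (Xi_orthonormal : forall j, (Xi j)^T *m Xi j = 1%:M)
  (ups : R) (ups_range : 0 <= ups <= 1)
  (w : nat -> 'I_Nbar -> nat)
  (Xiloc : forall (n : nat) (j : 'I_Nbar), 'M[R]_(mbar, w n j))
  (Xiloc_basis : forall (n : nat) (j : 'I_Nbar), (n < M)%N ->
     truncated_left_basis ups (Zmx R m mbar n *m Xi j) (Xiloc n j))
  (* the sampled least-squares problems defining the forecast have a unique
     solution, i.e. full column rank, wherever the local basis is nontrivial *)
  (well_posed : forall (n : nat) (j : 'I_Nbar), (n < M)%N ->
     Zmx R m mbar n *m Xi j != 0 ->
     \rank (Z0 R mbar alpha *m Xiloc n j) = w n j)
  (eps : R) (eps_ge0 : 0 <= eps)
  (xinit : nat -> 'cV[R]_N) (xinit0 : xinit 0%N = x0)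
  (hyp_i : forall j : 'I_Nbar,
     range (mulmx (Xi j) : 'cV[R]_a -> 'cV[R]_m)
       (hvec Tfinal m (fun t => (Rr^T *m F x0 0 t) j 0)))
  (hyp_ii : ups = 1)
  (hyp_iii : [/\ P *m Rr^T = 1%:M, Rr^T *m P = 1%:M & Nbar = N])
  (hyp_iv : forall n : nat, (n < M)%N ->
     xinit n.+1 = G_LF Tfinal m alpha F Rr P Xiloc (xinit n) n) :
  let Fc (xi : 'cV[R]_N) (n : nat) :=
    F xi (tcoarse Tfinal m mbar n) (tcoarse Tfinal m mbar n.+1) in
  let K := parareal_iterations M Fc
             (G_LF Tfinal m alpha F Rr P Xiloc) eps xinit in
  K = 0%N /\
  forall (tau : nat -> R) (other_serial : nat -> nat -> 'I_1 -> R)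
    (other_parareal : nat -> nat -> 'I_M -> R),
    (forall l, 0 < tau l) ->
    dominated tau other_serial -> dominated tau other_parareal ->
    wall_time (tau l) (other_serial l) (serial_stages m) /
      wall_time (tau l) (other_parareal l) (lf_lf_stages M mbar alpha K)
    @[l --> \oo] --> (m%:R / ((M%:R - 1) * alpha%:R + mbar%:R) : R).
Proof.
have [PRr _ _] := hyp_iii; have /andP[_ alpha_le] := alpha_range.
rewrite hyp_ii in Xiloc_basis.
set G := G_LF _ _ _ _ _ _ _ in hyp_iv *; move=> Fc.
have initE n : (n <= M)%N -> xinit n = F x0 0 (tcoarse Tfinal m mbar n).
  elim: n => [_|n IHn nM].
    rewrite xinit0 tcoarseE muln0; have [idF _] := F_propagator.
    by rewrite -{1}(idF 0%N x0) // /tfine mul0r.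
  rewrite hyp_iv // IHn 1?ltnW // /G.
  exact: (G_LF_exact mE mbar_gt0 alpha_le F_propagator Xiloc_basis well_posed).
have K0 : parareal_iterations M Fc G eps xinit = 0%N.
  apply: parareal_iterations_eq0 => //.
  (* The test skips index 0. At [n.+1] the numerator vanishes, so the quotient is 0 whatever its
     denominator, and 0 does not exceed [eps]. *)
  apply/forallP => -[[|n] nM]; first by [].
  rewrite /= (initE n) 1?ltnW 1?ltnW // (initE n.+1) 1?ltnW // /Fc.
  rewrite !tcoarseE (fine_restart F_propagator); last first.
  - by rewrite mE leq_mul // ltnW.
  - by rewrite leq_mul2l leqnSn orbT.
  rewrite subrr (_ : norm2 0 = 0) ?mul0r -?leNgt //.
  by rewrite /norm2 big1 ?sqrtr0 // => i _; rewrite mxE expr0n.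
split=> // tau os op tau0 domS domP; rewrite K0.
have den0 : (M%:R - 1) * alpha%:R + mbar%:R != 0 :> R.
  rewrite gt_eqF // ltr_wpDl ?ltr0n // mulr_ge0 // subr_ge0 ler1n //.
have := cvgM (wall_time_cvg (stages := serial_stages m) tau0 domS)
  (cvgV _ (wall_time_cvg (stages := lf_lf_stages M mbar alpha 0) tau0 domP)).
rewrite ideal_cost_serial ideal_cost_lf_lf // => /(_ _ _ den0).
(* The factors [tau l] cancel between the two normalized wall times. *)
apply: cvg_trans; apply: near_eq_cvg; near=> l.
by rewrite /= invf_div mulrA divfK ?gt_eqF.
Unshelve. all: by end_near.
Qed.
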